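(* Let $n,m\ge 1$ be integers and let $\kappa\in\mathbb C$, $\kappa\neq 0$. The algebra $\Lambda_{n,m,\kappa}$ separates the orbits of the action $\Phi_\kappa$ of the super Weyl groupoid $\mathcal W_{n,m}$ on $V=\mathbb C^{n+m}$ if and only if $\kappa$ is not special.
   Context: Let $V=\mathbb C^{n+m}$ with coordinates $(u,v)=(u_1,\dots,u_n,v_1,\dots,v_m)$. The action $\Phi_\kappa$ of the super Weyl groupoid $\mathcal W_{n,m}$ on $V$ is given by the following (partially defined) affine bijections: (i) the group $S_n\times S_m$ acts on $V$ by permuting $u_1,\dots,u_n$ and $v_1,\dots,v_m$ separately; (ii) for each $1\le i\le n$, $1\le p\le m$, the shift $(u,v)\mapsto(u_1,\dots,u_i+1,\dots,u_n,v_1,\dots,v_p-1,\dots,v_m)$, defined only on the hyperplane $u_i-\kappa v_p=-\tfrac12(1+\kappa)$ and mapping it onto the hyperplane $u_i-\kappa v_p=\tfrac12(1+\kappa)$; (iii) the inverses of the shifts in (ii). The orbit of $z\in V$ is the set of all points obtained from $z$ by applying successively finitely many of these maps, each one at a point where it is defined. Put $x_i=u_i+\frac12+\kappa$ ($1\le i\le n$) and $y_p=\kappa v_p+\frac{\kappa}{2}$ ($1\le p\le m$). In the coordinates $(x,y)$ the shift in (ii) becomes $x_i\mapsto x_i+1$, $y_p\mapsto y_p-\kappa$ (other coordinates fixed), defined on the hyperplane $x_i=y_p$. $\Lambda_{n,m,\kappa}$ is the subalgebra of $\mathbb C[u_1,\dots,u_n,v_1,\dots,v_m]$ generated by the polynomials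 $$q_l(x,y,\kappa)=\sum_{i=1}^n\left[x_i^{l+1}-(x_i-\kappa)^{l+1}\right]+\sum_{p=1}^m\left[(y_p+1)^{l+1}-y_p^{l+1}\right],\qquad l\in\mathbb N=\{1,2,\dots\}.$$ These polynomials are constant on the orbits of $\Phi_\kappa$. An algebra of invariants separates the orbits if for any two distinct orbits there is an element of the algebra taking different values on them. $\kappa$ is called special if $\kappa=\frac pq$ or $\kappa=-\frac pq$ for some integers $1\le p\le m$, $1\le q\le n$. *)

(* Defs.v *)
From mathcomp Require Import all_boot all_order all_algebra all_fingroup.
From mathcomp Require Import boolp classical_sets reals.
From mathcomp Require Import complex.
From mathcomp Require Import mpoly.
From Stdlib Require Import Relations.

Set Implicit Arguments.
Unset Strict Implicit.
Unset Printing Implicit Defensive.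

Import GRing.Theory.
Local Open Scope ring_scope.

Definition special (K : fieldType) (n m : nat) (kappa : K) : Prop :=
  exists p q : nat,
    [/\ (1 <= p <= m)%N, (1 <= q <= n)%N &
        kappa = p%:R / q%:R \/ kappa = - (p%:R / q%:R)].

(* A point z of V = K^(n+m) is a row vector; its first n entries are
   u_1, ..., u_n and its last m entries are v_1, ..., v_m. *)
Definition u_coord (K : fieldType) (n m : nat) (z : 'rV[K]_(n + m)) (i : 'I_n) : K :=
  z 0 (lshift m i).

Definition v_coord (K : fieldType) (n m : nat) (z : 'rV[K]_(n + m)) (p : 'I_m) : K :=
  z 0 (rshift n p).

Definition permute (K : fieldType) (n m : nat) (s : 'S_n) (t : 'S_m)
    (z : 'rV[K]_(n + m)) : 'rV[K]_(n + m) :=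
  row_mx (\row_i u_coord z (s i)) (\row_p v_coord z (t p)).

(* The graph of the partially defined shift u_i |-> u_i + 1, v_p |-> v_p - 1. *)
Definition shift (K : fieldType) (n m : nat) (kappa : K) (i : 'I_n) (p : 'I_m)
    (z w : 'rV[K]_(n + m)) : Prop :=
  u_coord z i - kappa * v_coord z p = - (2%:R^-1 * (1 + kappa)) /\
  w = z + delta_mx 0 (lshift m i) - delta_mx 0 (rshift n p).

Inductive Phi_step (K : fieldType) (n m : nat) (kappa : K)
    (z w : 'rV[K]_(n + m)) : Prop :=
  | Phi_perm (s : 'S_n) (t : 'S_m) of w = permute s t z
  | Phi_shift (i : 'I_n) (p : 'I_m) of shift kappa i p z w
  | Phi_shift_inv (i : 'I_n) (p : 'I_m) of shift kappa i p w z.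

Definition Phi_orbit (K : fieldType) (n m : nat) (kappa : K) (z : 'rV[K]_(n + m)) :
    set 'rV[K]_(n + m) :=
  [set w | clos_refl_trans _ (Phi_step kappa) z w]%classic.

Inductive generated_subalgebra (K : fieldType) (A : algType K) (G : set A) : set A :=
  | gen_mem (f : A) of G f : generated_subalgebra G f
  | gen_one : generated_subalgebra G 1
  | gen_lin (a : K) (f g : A) of generated_subalgebra G f & generated_subalgebra G g :
      generated_subalgebra G (a *: f + g)
  | gen_mul (f g : A) of generated_subalgebra G f & generated_subalgebra G g :
      generated_subalgebra G (f * g).

Definition x_poly (K : fieldType) (n m : nat) (kappa : K) (i : 'I_n) : {mpoly K[n + m]} :=
  'X_(lshift m i) + (2%:R^-1 + kappa)%:MP.

Definition y_poly (K : fieldType) (n m : nat) (kappa : K) (p : 'I_m) : {mpoly K[n + m]} :=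
  kappa *: 'X_(rshift n p) + (kappa / 2%:R)%:MP.

Definition q_poly (K : fieldType) (n m : nat) (kappa : K) (l : nat) : {mpoly K[n + m]} :=
  \sum_(i < n) (x_poly m kappa i ^+ l.+1 - (x_poly m kappa i - kappa%:MP) ^+ l.+1) +
  \sum_(p < m) ((y_poly n kappa p + 1) ^+ l.+1 - y_poly n kappa p ^+ l.+1).

Definition Lambda (K : fieldType) (n m : nat) (kappa : K) : set {mpoly K[n + m]} :=
  generated_subalgebra [set f | exists2 l, (1 <= l)%N & f = q_poly n m kappa l]%classic.

Arguments Lambda {K} n m kappa.

Definition separates_orbits (K : fieldType) (n m : nat) (kappa : K)
    (L : set {mpoly K[n + m]}) : Prop :=
  forall z1 z2 : 'rV[K]_(n + m), Phi_orbit kappa z1 <> Phi_orbit kappa z2 ->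
  exists2 f, L f &
    forall w1 w2, Phi_orbit kappa z1 w1 -> Phi_orbit kappa z2 w2 ->
      f.@[fun j => w1 0 j] <> f.@[fun j => w2 0 j].

(* Main.v *)
(* In the coordinates x, y the basic move replaces x_i = y_p = a by
   x_i = a + 1, y_p = a - kappa. All q_l agree at two points iff the divisors
   sum_i ([x_i] - [x_i - kappa]) + sum_p ([y_p + 1] - [y_p]) agree (Newton).
   Write al = 1, be = - kappa and assume that no q be with 1 <= q <= n lies in
   Z al; if kappa is not special, this holds either as stated or after
   exchanging (x, n, al) with (y, m, be).
   Equal divisors produce an integer function F on the line, the "net number of
   moves based at a", with X1 - X2 = F(a - al) - F(a), Y1 - Y2 = F(a - be) - F(a).
   F has finite support: otherwise X1 and X2 would have different numbers of
   points in some coset a + Z al, hence in all the distinct cosets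
   a - j be + Z al, 0 <= j <= n, which is too many for n points.
   Where F attains a positive maximum a legal move exists: if at each maximum
   point a that is lowest in its coset of Z al the value F(a - be) were again
   maximal, then X2 would meet all the cosets a - j be + Z al.
   Such a move decreases sum |F|, so the two points are connected.
   Conversely, if kappa = +-p/q, strings of q coordinates x_i and p coordinates
   y_j in arithmetic progression telescope in all q_l, which gives two points
   with the same invariants, only one of which has all u_i real. *)

Require Import Defs.
From mathcomp Require Import all_boot all_order all_algebra all_fingroup.
From mathcomp Require Import boolp classical_sets reals.
From mathcomp Require Import complex.
From mathcomp Require Import mpoly.
From mathcomp Require Import zify ring.
From Stdlib Require Import Relations.

Set Implicit Arguments.
Unset Strict Implicit.
Unset Printing Implicit Defensive.

Import Order.TTheory GRing.Theory Num.Theory.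
Local Open Scope ring_scope.

(** * Power sums determine a multiset *)

(** A polynomial vanishing at every point of [s ++ t] other than [c] isolates the multiplicity of
    [c], which characteristic zero allows to be read off in [K]. *)
Lemma power_sums_perm_eq (K : numDomainType) (s t : seq K) :
  (forall k, \sum_(a <- s) a ^+ k = \sum_(a <- t) a ^+ k) -> perm_eq s t.
Proof.
move=> hst.
have sum_horner (p : {poly K}) : \sum_(a <- s) p.[a] = \sum_(a <- t) p.[a].
  under eq_bigr do rewrite horner_coef.
  under [RHS]eq_bigr do rewrite horner_coef.
  rewrite exchange_big [RHS]exchange_big /=; apply: eq_bigr => i _.
  by rewrite -!mulr_sumr hst.
rewrite /perm_eq; apply/allP => c cst /=; apply/eqP.
pose p := \prod_(b <- rem c (undup (s ++ t))) ('X - b%:P).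
have pE a : p.[a] = \prod_(b <- rem c (undup (s ++ t))) (a - b).
  by rewrite horner_prod; apply: eq_bigr => b _; rewrite hornerXsubC.
have pc : p.[c] != 0.
  rewrite pE prodf_seq_neq0; apply/allP => b.
  by rewrite mem_rem_uniq ?undup_uniq // inE => /andP[bc _]; rewrite subr_eq0 eq_sym.
have pa a : a \in s ++ t -> p.[a] = (a == c)%:R * p.[c].
  move=> ast; case: eqVneq => [->|ac]; first by rewrite mul1r.
  rewrite mul0r pE; apply/eqP; rewrite prodf_seq_eq0; apply/hasP.
  by exists a; rewrite ?subrr //= mem_rem_uniq ?undup_uniq // inE ac mem_undup.
have count_sum (r : seq K) : {subset r <= s ++ t} ->
    \sum_(a <- r) p.[a] = (count_mem c r)%:R * p.[c].
  move=> rst; rewrite big_seq_cond.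
  under eq_bigr => a /andP[ar _] do rewrite pa ?rst //.
  rewrite -big_seq_cond -mulr_suml; congr (_ * _).
  by rewrite -sum1_count -natr_sum [in RHS]big_mkcond; congr (_%:R).
have := sum_horner p.
rewrite !count_sum => [/(mulIf pc)/eqP|a|a]; rewrite ?mem_cat; last 2 first.
- by move=> ->; rewrite orbT.
- by move=> ->.
by rewrite eqr_nat => /eqP.
Qed.

(** * Rays and cosets in direction [al] *)

Section Lines.
Variables (K : numDomainType) (al be : K).
Hypothesis al0 : al != 0.

(** The ray starts strictly after [a], so that moving its origin back to [a - al] adds exactly the
    point [a]. Counts on rays are thus discrete primitives of multiplicities. *)
Definition ray a x := `[< exists k : nat, x = a + al *+ k.+1 >].
Definition line a x := `[< exists k : int, x = a + al *~ k >].

Lemma ray_shift a c x : ray a (x + c) = ray (a - c) x.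
Proof.
apply/asboolP/asboolP => -[k h]; exists k; first by rewrite addrAC -h addrK.
by rewrite h addrAC subrK.
Qed.

Lemma line_shift a c x : line a (x + c) = line (a - c) x.
Proof.
apply/asboolP/asboolP => -[k h]; exists k; first by rewrite addrAC -h addrK.
by rewrite h addrAC subrK.
Qed.

Lemma line_step a : line (a - al) =1 line a.
Proof.
move=> x; apply/asboolP/asboolP => -[k ->].
  by exists (k - 1); rewrite mulrzBr mulr1z addrA addrAC.
by exists (k + 1); rewrite mulrzDr mulr1z (addrC _ al) addrA subrK.
Qed.

Lemma ray_step a x : (ray (a - al) x = (x == a) + ray a x :> nat)%N.
Proof.
have inj k : a + al *+ k.+1 <> a.
  by move/eqP; rewrite -subr_eq0 addrAC subrr add0r mulrn_eq0 (negPf al0).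
case: eqVneq => [->|xa].
  have -> : ray (a - al) a by apply/asboolP; exists 0%N; rewrite mulr1n subrK.
  case: (boolP (ray a a)) => // /asboolP[k] /esym; by move/inj.
congr nat_of_bool; apply/asboolP/asboolP => -[k h].
  case: k h => [|k] h; first by rewrite h mulr1n subrK eqxx in xa.
  by exists k; rewrite h mulrS addrA subrK.
by exists k.+1; rewrite h [in RHS]mulrS addrA subrK.
Qed.

Lemma count_ray_step a s :
  (count (ray (a - al)) s = count_mem a s + count (ray a) s)%N.
Proof. by elim: s => //= x s ->; rewrite ray_step addnACA. Qed.

Lemma line_far_ray x y :
  exists k0 : nat, forall k, (k0 <= k)%N ->
    line (x - al *+ k.+1) y -> ray (x - al *+ k.+1) y.
Proof.
have [/asboolP[j ->]|/asboolPn nxy] := boolP (line x y).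
  exists `|j|%N => k jk _; apply/asboolP; exists `|(j + k%:Z)%R|%N.
  rewrite !pmulrn (_ : (`|(j + k%:Z)%R|.+1)%:Z = j + k.+1%:Z); last by lia.
  by rewrite mulrzDr (addrC (al *~ j)) addrA subrK.
exists 0%N => k _ /asboolP[j yE]; case: nxy; exists (j - k.+1%:Z).
by rewrite yE mulrzBr -pmulrn addrA addrAC.
Qed.

End Lines.

Lemma uniform_threshold (T : eqType) (s : seq T) (Q : T -> nat -> Prop) :
  (forall x, x \in s -> exists k0, forall k, (k0 <= k)%N -> Q x k) ->
  exists k0, forall x k, x \in s -> (k0 <= k)%N -> Q x k.
Proof.
elim: s => [|y s IH] h; first by exists 0%N.
have [k1 h1] := h y (mem_head y s).
have [|k2 h2] := IH; first by move=> x xs; apply: h; rewrite inE xs orbT.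
exists (maxn k1 k2) => x k; rewrite inE geq_max => /orP[/eqP->|xs] /andP[k1k k2k].
  exact: h1.
exact: h2.
Qed.

(** * Equal divisors and the flow between two configurations *)

Section Transport.
Variables (K : numDomainType) (al be : K) (n : nat).
Hypothesis al0 : al != 0.
Hypothesis incommensurable :
  forall (q : nat) (k : int), (1 <= q <= n)%N -> be *+ q <> al *~ k.

(** Incommensurability makes the cosets for [j <= n] pairwise distinct, so meeting all of them takes
    [n + 1] different points. *)
Lemma lines_missing (s : seq K) a : (size s <= n)%N ->
  (forall j, has (line al (a - be *+ j)) s) -> False.
Proof.
move=> sn hs; pose g (j : 'I_n.+1) := nth 0 s (find (line al (a - be *+ j)) s).
have gline (j : 'I_n.+1) : line al (a - be *+ j) (g j) by apply: nth_find; apply: hs.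
have gs (j : 'I_n.+1) : g j \in s by rewrite mem_nth // -has_find; apply: hs.
have glt (j j' : 'I_n.+1) : (j < j')%N -> g j <> g j'.
  move=> jj' gg; have /asboolP[k1 e1] := gline j; have /asboolP[k2 e2] := gline j'.
  apply: (incommensurable (q := (j' - j)%N) (k := k2 - k1)).
    by have := ltn_ord j'; lia.
  rewrite mulrnBr ?(ltnW jj') // mulrzBr.
  move: gg; rewrite e1 e2 => gg; apply/eqP; rewrite -subr_eq0; apply/eqP.
  have -> : be *+ j' - be *+ j - (al *~ k2 - al *~ k1) =
    (a - be *+ j + al *~ k1) - (a - be *+ j' + al *~ k2) by ring.
  by rewrite gg subrr.
have ginj : injective g.
  move=> j j' gg; apply: val_inj => /=; case: (ltngtP j j') => // /glt h.
    by case: h.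
  by case: h; rewrite gg.
have : (size (map g (enum 'I_n.+1)) <= size s)%N.
  apply: uniq_leq_size; first by rewrite map_inj_uniq ?enum_uniq.
  by move=> x /mapP[j _ ->].
by rewrite size_map size_enum_ord ltnNge sn.
Qed.

(* [x1 - (x1 + be) + (y1 + al) - y1] as a divisor, compared with that of
   [(x2, y2)]; negative terms are moved to the other side. *)
Definition same_divisor (x1 y1 x2 y2 : seq K) :=
  perm_eq (x1 ++ [seq y + al | y <- y1] ++ [seq x + be | x <- x2] ++ y2)
          (x2 ++ [seq y + al | y <- y2] ++ [seq x + be | x <- x1] ++ y1).

Section Flow.
Variables x1 y1 x2 y2 : seq K.

(** This is the function [F] of the introduction: the primitive along [al] of the difference of
    multiplicities of [x1] and [x2] that vanishes far out in the direction of [al]. *)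
Definition flow a : int :=
  (count (ray al a) x1)%:Z - (count (ray al a) x2)%:Z.

Hypothesis dxy : same_divisor x1 y1 x2 y2.

(** Translation by [al] preserves a coset, so the [y] terms of the divisor cancel there. The excess
    of [x1] over [x2] is therefore unchanged from the coset of [a] to that of [a - be]. *)
Lemma line_count_step a :
  (count (line al a) x1 + count (line al (a - be)) x2 =
   count (line al a) x2 + count (line al (a - be)) x1)%N.
Proof.
have := seq.permP dxy (line al a); rewrite !count_cat !count_map.
have eal s : count (preim (+%R^~ al) (line al a)) s = count (line al a) s.
  by apply: eq_count => x /=; rewrite line_shift line_step.
have ebe s : count (preim (+%R^~ be) (line al a)) s = count (line al (a - be)) s.
  by apply: eq_count => x /=; rewrite line_shift.
have arith (p p' q q' r r' : nat) :
  (p + (q + (r' + q')) = p' + (q' + (r + q)) -> p + r' = p' + r)%N by lia.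
by rewrite !eal !ebe; apply: arith.
Qed.

Lemma flow_x a :
  (count_mem a x1)%:Z = (count_mem a x2)%:Z + flow (a - al) - flow a.
Proof. by rewrite /flow !count_ray_step // !PoszD; ring. Qed.

(** Count the divisor on the ray from [a]: the [y] terms leave only the multiplicities at [a], and
    the [x] terms give [flow a - flow (a - be)]. *)
Lemma flow_y a :
  (count_mem a y1)%:Z = (count_mem a y2)%:Z + flow (a - be) - flow a.
Proof.
have := seq.permP dxy (ray al a); rewrite !count_cat !count_map.
have eal s : count (preim (+%R^~ al) (ray al a)) s =
    (count_mem a s + count (ray al a) s)%N.
  by rewrite -count_ray_step //; apply: eq_count => x /=; rewrite ray_shift.
have ebe s : count (preim (+%R^~ be) (ray al a)) s = count (ray al (a - be)) s.
  by apply: eq_count => x /=; rewrite ray_shift.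
have arith (p p' q q' r r' s s' : nat) :
    (p + (s + q + (r' + q')) = p' + (s' + q' + (r + q)))%N ->
     s%:Z = s'%:Z + (r%:Z - r'%:Z) - (p%:Z - p'%:Z) by lia.
by rewrite /flow !eal !ebe; apply: arith.
Qed.

(** An excess of [x1] on one coset propagates by [line_count_step] to all the cosets of
    [lines_missing]. *)
Lemma line_count_le a : (size x1 <= n)%N ->
  (count (line al a) x1 <= count (line al a) x2)%N.
Proof.
move=> s1; rewrite leqNgt; apply/negP => lt21.
apply: (lines_missing (a := a) s1) => j; rewrite has_count.
suff: (count (line al (a - be *+ j)) x2 < count (line al (a - be *+ j)) x1)%N.
  exact: leq_ltn_trans.
elim: j => [|j IH]; first by rewrite mulr0n subr0.
have arith (p p' q q' : nat) : (p + q' = p' + q -> p' < p -> q' < q)%N by lia.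
rewrite mulrSr opprD addrA; apply: arith IH; exact: line_count_step.
Qed.

End Flow.

Lemma same_divisor_sym x1 y1 x2 y2 :
  same_divisor x1 y1 x2 y2 -> same_divisor x2 y2 x1 y1.
Proof. by rewrite /same_divisor perm_sym. Qed.

(* Far below its points, the ray from [a] is the whole line through [a]. *)
Lemma flow_support x1 y1 x2 y2 : same_divisor x1 y1 x2 y2 ->
  (size x1 <= n)%N -> (size x2 <= n)%N ->
  exists2 U : seq K, uniq U & forall a, a \notin U -> flow x1 x2 a = 0.
Proof.
move=> d s1 s2.
have eq_line a : count (line al a) x1 = count (line al a) x2.
  apply/eqP; rewrite eqn_leq (line_count_le d) //.
  by rewrite (line_count_le (same_divisor_sym d)).
pose s := x1 ++ x2.
have [k0 hk0] : exists k0, forall x k, x \in s -> (k0 <= k)%N -> forall y, y \in s ->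
    line al (x - al *+ k.+1) y -> ray al (x - al *+ k.+1) y.
  apply: uniform_threshold => x xs.
  have [k0 h] := @uniform_threshold _ s (fun y k =>
      line al (x - al *+ k.+1) y -> ray al (x - al *+ k.+1) y)
    (fun y _ => line_far_ray al0 x y).
  by exists k0 => k kk y ys; apply: h.
(* For [a] outside this set, either the ray meets no point of [s], or it starts so far back that it
   contains all points of [s] on its coset, where the two counts agree. *)
exists (undup [seq x - al *+ k.+1 | x <- s, k <- iota 0 k0]); first exact: undup_uniq.
move=> a; rewrite mem_undup => aU; apply/eqP; rewrite subr_eq0 eqz_nat.
have [/hasP[x xs /asboolP[k xE]]|] := boolP (has (ray al a) s); last first.
  by rewrite has_cat !has_count !lt0n; case/norP => /negPn/eqP-> /negPn/eqP->.
have aE : a = x - al *+ k.+1 by rewrite xE addrK.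
have k0k : (k0 <= k)%N.
  rewrite leqNgt; apply: contra aU => kk0.
  by apply/allpairsP; exists (x, k); rewrite xs mem_iota.
have eq_ray r : {subset r <= s} -> count (ray al a) r = count (line al a) r.
  move=> rs; apply: eq_in_count => y yr; apply/idP/idP => [/asboolP[j ->]|].
    by apply/asboolP; exists j.+1%:Z.
  by rewrite aE; apply: hk0 => //; apply: rs.
by rewrite !eq_ray ?eq_line // => y yr; rewrite mem_cat yr ?orbT.
Qed.

(** * Realizing a flow by legal moves *)

Section Realization.
Variables (T : Type) (xs ys : T -> seq K) (E : T -> T -> Prop).
Hypothesis size_xs : forall z, size (xs z) = n.
Hypothesis E_sym : forall z w, E z w -> E w z.
Hypothesis E_trans : forall z w t, E z w -> E w t -> E z t.
Hypothesis E_perm : forall z w,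
  perm_eq (xs z) (xs w) -> perm_eq (ys z) (ys w) -> E z w.
Hypothesis E_move : forall z a, a \in xs z -> a \in ys z ->
  exists w, [/\ E z w, perm_eq (xs w) (a + al :: rem a (xs z)) &
                perm_eq (ys w) (a + be :: rem a (ys z))].

(* [F] counts the moves leading from [z2] to [z1]. *)
Definition net_moves (F : K -> int) z1 z2 :=
  (forall a, (count_mem a (xs z1))%:Z =
             (count_mem a (xs z2))%:Z + F (a - al) - F a) /\
  (forall a, (count_mem a (ys z1))%:Z =
             (count_mem a (ys z2))%:Z + F (a - be) - F a).

Variable U : seq K.
Hypothesis U_uniq : uniq U.

Lemma exists_max (F : K -> int) b : (forall a, a \notin U -> F a = 0) -> 0 < F b ->
  exists a, 0 < F a /\ forall c, F c <= F a.
Proof.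
move=> FU Fb; suff [a [ab ha]] : exists a, F b <= F a /\ forall c, c \in U -> F c <= F a.
  exists a; split=> [|c]; first exact: lt_le_trans ab.
  by have [/ha//|/FU->] := boolP (c \in U); apply: le_trans ab; apply: ltW.
elim: (U) => [|c s [a [ab ha]]]; first by exists b.
have [ca|ac] := leP (F c) (F a).
  by exists a; split=> // d; rewrite inE => /orP[/eqP->|/ha].
exists c; split=> [|d]; first exact/ltW/(le_lt_trans ab).
by rewrite inE => /orP[/eqP->|/ha da] //; apply/ltW/(le_lt_trans da).
Qed.

Lemma exists_move F z1 z2 b : net_moves F z1 z2 ->
  (forall a, a \notin U -> F a = 0) -> 0 < F b ->
  exists a, [/\ 0 < F a, a \in xs z2 & a \in ys z2].
Proof.
move=> [Fx Fy] FU Fb; have [m [Fm maxm]] := exists_max FU Fb.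
have arith (p p' : nat) (r s : int) : p%:Z = p'%:Z + r - s -> r < s -> (0 < p')%N.
  by lia.
(* Multiplicities of [z1] are nonnegative, so a strict rise of [F] into [a] forces a point of [z2]
   at [a]. *)
have in_xs a : F (a - al) < F a -> a \in xs z2.
  by move=> h; rewrite -has_pred1 has_count; apply: arith (Fx a) h.
have in_ys a : F (a - be) < F a -> a \in ys z2.
  by move=> h; rewrite -has_pred1 has_count; apply: arith (Fy a) h.
apply: contrapT => nomove.
(* At a maximum with a drop along [al], a drop along [be] as well would make a move legal. *)
have nodrop a : F a = F m -> F (a - al) < F a -> F (a - be) = F m.
  move=> am aal; apply/eqP; rewrite eq_le maxm /= leNgt -am; apply/negP => abe.
  by apply: nomove; exists a; split; [rewrite am|apply: in_xs|apply: in_ys].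
(* Going down by [al] must leave the maximal level: that level is positive, hence attained only
   inside the finite [U]. *)
have bottom a : F a = F m -> exists k, let a' := a - al *+ k in
    F a' = F m /\ F (a' - al) < F a'.
  move=> am; apply: contrapT => nobot.
  have all_m k : F (a - al *+ k) = F m.
    elim: k => [|k IH]; first by rewrite mulr0n subr0.
    rewrite mulrSr opprD addrA; apply/eqP; rewrite eq_le maxm /= leNgt -IH.
    by apply/negP => h; apply: nobot; exists k.
  have : (size [seq (a - al *+ k)%R | k <- iota 0 (size U).+1] <= size U)%N.
    apply: uniq_leq_size.
      rewrite map_inj_uniq ?iota_uniq // => k k' /addrI/oppr_inj/eqP.
      by rewrite !pmulrn => /eqP/(mulrIz al0)[].
    move=> _ /mapP[k _ ->]; apply: contraT => /FU; rewrite all_m => e.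
    by rewrite e ltxx in Fm.
  by rewrite size_map size_iota ltnn.
(* Alternating steps by [be] with descents along [al] produce points of [z2] on every coset of
   [m - be *+ j]. *)
suff chain j : exists a, [/\ line al (m - be *+ j) a, F a = F m & F (a - al) < F a].
  apply: (lines_missing (a := m) (s := xs z2)); first by rewrite size_xs.
  by move=> j; have [a [la _ /in_xs ax]] := chain j; apply/hasP; exists a.
elim: j => [|j [a [/asboolP[k aE] am aal]]].
  have [k [/= h1 h2]] := bottom m erefl; exists (m - al *+ k); split=> //.
  by apply/asboolP; exists (- k%:Z); rewrite mulr0n subr0 mulrNz -pmulrn.
have [k' [/= h1 h2]] := bottom _ (nodrop a am aal); exists (a - be - al *+ k'); split=> //.
by apply/asboolP; exists (k - k'%:Z); rewrite aE mulrzBr -pmulrn mulrSr; ring.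
Qed.

(** Induction on a bound for the sum of [|F|] over [U]: a move lowers a positive value of [F] by
    one, a negative value is treated by exchanging [z1] and [z2], and [F = 0] means equal
    multisets. *)
Lemma net_moves_related F z1 z2 : net_moves F z1 z2 ->
  (forall a, a \notin U -> F a = 0) -> E z1 z2.
Proof.
move: {2}_.+1 (ltnSn (\sum_(a <- U) `|F a|%N)%N) => N.
elim: N F z1 z2 => // N IH F z1 z2; rewrite ltnS => FN Fz FU.
have pos (G : K -> int) w1 w2 b : (\sum_(a <- U) `|G a|%N <= N)%N ->
    net_moves G w1 w2 -> (forall a, a \notin U -> G a = 0) -> 0 < G b -> E w1 w2.
  move=> GN Gw GU Gb; have [a [Ga ax ay]] := exists_move Gw GU Gb.
  have [w [Ew wx wy]] := E_move ax ay.
  have [Gx Gy] := Gw.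
  (* Once the move at [a] has led from [w2] to [w], one move fewer based at [a] separates [w] from
     [w1]. *)
  apply: E_trans (E_sym Ew); pose H c : int := G c - (c == a)%:Z.
  have aU : a \in U by apply: contraT => /GU Ga0; rewrite Ga0 ltxx in Ga.
  have cnt d v w' c : v \in w' -> count_mem c (d :: rem v w') =
      ((d == c) + (count_mem c w' - (v == c)))%N.
    by move=> vw; rewrite /= count_rem vw.
  have cnt1 (v : K) w' : v \in w' -> (0 < count_mem v w')%N.
    by rewrite -has_pred1 has_count.
  have arith (p : nat) (e e' : bool) (r s : int) : (e <= p)%N ->
      p%:Z + r - s = (e' + (p - e))%:Z + (r - e'%:Z) - (s - e%:Z) by lia.
  apply: (IH H).
  - have HG : (\sum_(c <- U | c != a) `|H c| = \sum_(c <- U | c != a) `|G c|)%N.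
      by apply: eq_bigr => c /negPf ca; rewrite /H ca subr0.
    move: GN; rewrite !(bigD1_seq a) //= HG /H eqxx.
    have lt1 (g : int) (p : nat) : 0 < g -> (`|g| + p <= N -> `|(g - 1)%R| + p < N)%N by lia.
    exact: lt1.
  - split=> c.
      rewrite (seq.permP wx) cnt // Gx /H subr_eq [a + al == _]eq_sym [a == c]eq_sym.
      by case: (eqVneq c a) => [->|_]; apply: arith; rewrite ?cnt1.
    rewrite (seq.permP wy) cnt // Gy /H subr_eq [a + be == _]eq_sym [a == c]eq_sym.
    by case: (eqVneq c a) => [->|_]; apply: arith; rewrite ?cnt1.
  - move=> c cU; rewrite /H GU //; case: eqVneq cU => [->|//]; by rewrite aU.
have [[b Fb]|/forallNP nonpos] := pselect (exists b, 0 < F b).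
  exact: (pos F) Fb.
have [[b Fb]|/forallNP nonneg] := pselect (exists b, F b < 0).
  apply: E_sym; apply: (pos (fun c => - F c) _ _ b).
  - by under eq_bigr do rewrite abszN.
  - by have [Fx Fy] := Fz; split=> a; [rewrite Fx|rewrite Fy]; ring.
  - by move=> a /FU->; rewrite oppr0.
  - by rewrite oppr_gt0.
have F0 a : F a = 0.
  by apply/eqP; rewrite eq_le !leNgt; apply/andP; split; apply/negP.
have [Fx Fy] := Fz.
apply: E_perm; apply/allP => a _ /=; rewrite -eqz_nat; apply/eqP.
  by rewrite Fx !F0 addr0 subr0.
by rewrite Fy !F0 addr0 subr0.
Qed.

End Realization.

(** The configurations and [E] stay abstract so that [xs] and [ys] may also be used with their roles
    exchanged. *)
Lemma same_divisor_related T (xs ys : T -> seq K) (E : T -> T -> Prop) :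
  (forall z, size (xs z) = n) ->
  (forall z w, E z w -> E w z) -> (forall z w t, E z w -> E w t -> E z t) ->
  (forall z w, perm_eq (xs z) (xs w) -> perm_eq (ys z) (ys w) -> E z w) ->
  (forall z a, a \in xs z -> a \in ys z ->
     exists w, [/\ E z w, perm_eq (xs w) (a + al :: rem a (xs z)) &
                   perm_eq (ys w) (a + be :: rem a (ys z))]) ->
  forall z1 z2, same_divisor (xs z1) (ys z1) (xs z2) (ys z2) -> E z1 z2.
Proof.
move=> sz Esym Etrans Eperm Emove z1 z2 d.
have [||U Uuniq FU] := flow_support d; rewrite ?sz //.
apply: (net_moves_related sz Esym Etrans Eperm Emove Uuniq _ FU).
by split=> a; [apply: flow_x|apply: flow_y].
Qed.

End Transport.

(** * Orbits of the groupoid in the coordinates [x], [y] *)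

Section Orbits.
Variables (K : numFieldType) (n m : nat) (kappa : K).
Implicit Types z w : 'rV[K]_(n + m).

Definition x_coord z i : K := u_coord z i + (2%:R^-1 + kappa).
Definition y_coord z p : K := kappa * v_coord z p + kappa / 2%:R.
Definition xs z := [seq x_coord z i | i <- enum 'I_n].
Definition ys z := [seq y_coord z p | p <- enum 'I_m].

Lemma u_permute s t z i : u_coord (permute s t z) i = u_coord z (s i).
Proof. by rewrite /u_coord /permute row_mxEl mxE. Qed.

Lemma v_permute s t z p : v_coord (permute s t z) p = v_coord z (t p).
Proof. by rewrite /v_coord /permute row_mxEr mxE. Qed.

Lemma coords_inj z w :
  u_coord z =1 u_coord w -> v_coord z =1 v_coord w -> z = w.
Proof.
move=> hu hv; rewrite -[z]hsubmxK -[w]hsubmxK; congr row_mx; apply/rowP => i.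
  by rewrite !mxE; apply: hu.
by rewrite !mxE; apply: hv.
Qed.

Lemma Phi_step_sym z w : Phi_step kappa z w -> Phi_step kappa w z.
Proof.
case=> [s t ->|i p h|i p h].
- apply: (@Phi_perm _ _ _ _ _ _ (s^-1)%g (t^-1)%g); apply: coords_inj => i.
    by rewrite !u_permute permKV.
  by rewrite !v_permute permKV.
- exact: Phi_shift_inv h.
- exact: Phi_shift h.
Qed.

Lemma Phi_orbit_sym z w : Phi_orbit kappa z w -> Phi_orbit kappa w z.
Proof.
elim=> [a b /Phi_step_sym|a|a b c _ hba _ hcb]; first exact: rt_step.
  exact: rt_refl.
exact: rt_trans hcb hba.
Qed.

Lemma Phi_orbit_eq z w : Phi_orbit kappa z w -> Phi_orbit kappa z = Phi_orbit kappa w.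
Proof.
move=> h; apply/seteqP; split=> t ht; last exact: rt_trans h ht.
exact: rt_trans (Phi_orbit_sym h) ht.
Qed.

Lemma shift_defined z i p :
  (u_coord z i - kappa * v_coord z p = - (2%:R^-1 * (1 + kappa))) <->
  x_coord z i = y_coord z p.
Proof.
have e : x_coord z i - y_coord z p =
    u_coord z i - kappa * v_coord z p + 2%:R^-1 * (1 + kappa).
  by rewrite /x_coord /y_coord; field.
by split=> /eqP h; apply/eqP; move: h; rewrite -[_ == y_coord z p]subr_eq0 e addr_eq0.
Qed.

Lemma x_shift i p z w : shift kappa i p z w ->
  forall j, x_coord w j = if j == i then x_coord z i + 1 else x_coord z j.
Proof.
move=> [_ ->] j; rewrite /x_coord /u_coord !mxE /= !eq_shift subr0; case: eqVneq => [->|_]; last by rewrite addr0.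
by rewrite addrAC.
Qed.

Lemma y_shift i p z w : shift kappa i p z w ->
  forall j, y_coord w j = if j == p then y_coord z p - kappa else y_coord z j.
Proof.
move=> [_ ->] j; rewrite /y_coord /v_coord !mxE /= !eq_shift addr0; case: eqVneq => [->|_]; last by rewrite subr0.
by rewrite mulrBr mulr1 addrAC.
Qed.

Lemma perm_map_update (I : finType) (f g : I -> K) i :
  (forall j, j != i -> g j = f j) ->
  perm_eq [seq g j | j <- enum I] (g i :: rem (f i) [seq f j | j <- enum I]).
Proof.
move=> fg; have ei := perm_to_rem (mem_enum I i).
rewrite (perm_trans (perm_map g ei)) //= perm_cons.
rewrite (_ : map g _ = map f (rem i (enum I))); last first.
  by apply/eq_in_map => j; rewrite mem_rem_uniq ?enum_uniq // inE => /andP[/fg].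
rewrite -(perm_cons (f i)) perm_sym.
have fi : f i \in map f (enum I) by rewrite map_f ?mem_enum.
rewrite (perm_trans _ (perm_map f ei)) // perm_sym.
exact: perm_to_rem.
Qed.

Lemma orbit_move z a : a \in xs z -> a \in ys z ->
  exists w, [/\ Phi_orbit kappa z w, perm_eq (xs w) (a + 1 :: rem a (xs z)) &
                perm_eq (ys w) (a + - kappa :: rem a (ys z))].
Proof.
move=> /mapP[i _ ->] /mapP[p _ xy].
pose w := z + delta_mx 0 (lshift m i) - delta_mx 0 (rshift n p).
have zw : shift kappa i p z w by split=> //; apply/shift_defined.
have hx := x_shift zw; have hy := y_shift zw.
exists w; split; first by apply: rt_step; apply: Phi_shift zw.
  rewrite -[_ + 1](_ : x_coord w i = _); last by rewrite hx eqxx.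
  by apply: perm_map_update => j /negPf ji; rewrite hx ji.
rewrite xy -[_ + - _](_ : y_coord w p = _); last by rewrite hy eqxx.
by apply: perm_map_update => j /negPf jp; rewrite hy jp.
Qed.

Lemma perm_map_perm (N : nat) (f g : 'I_N -> K) :
  perm_eq [seq f j | j <- enum 'I_N] [seq g j | j <- enum 'I_N] ->
  exists s : 'S_N, forall j, g j = f (s j).
Proof.
rewrite perm_sym => /(@tuple_permP _ _ _ [tuple of [seq f j | j <- ord_tuple N]])[s hs].
exists s => j; have := congr1 (fun r => nth (f j) r j) hs.
rewrite (nth_map j) ?size_enum_ord // nth_ord_enum => ->.
rewrite -[LHS](tnth_nth _ [tuple _ | i < N] j) tnth_mktuple tnth_map.
by rewrite tnth_ord_tuple.
Qed.

Hypothesis kappa0 : kappa != 0.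

Lemma orbit_perm z w : perm_eq (xs z) (xs w) -> perm_eq (ys z) (ys w) ->
  Phi_orbit kappa z w.
Proof.
move=> /perm_map_perm[s hs] /perm_map_perm[t ht].
apply: rt_step; apply: (@Phi_perm _ _ _ _ _ _ s t); apply: coords_inj => i.
  by rewrite u_permute; apply: (addIr (2%:R^-1 + kappa)); apply: hs.
rewrite v_permute; apply: (mulfI kappa0); apply: (addIr (kappa / 2%:R)); exact: ht.
Qed.

(** If both alternatives fail, then [- kappa * q = k] and [p = - kappa * l] with [q <= n] and
    [p <= m]. In lowest terms [|k| / q] has a denominator dividing [q] and, because [p q = k l], a
    numerator dividing [p]; so [kappa] is special. *)
Lemma not_special_incommensurable : ~ special n m kappa ->
  (forall (q : nat) (k : int), (1 <= q <= n)%N -> - kappa *+ q <> 1 *~ k) \/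
  (forall (p : nat) (k : int), (1 <= p <= m)%N -> 1 *+ p <> (- kappa) *~ k).
Proof.
move=> nsp; apply: contrapT => /not_orP[hq hp]; apply: nsp.
have {hq} [q [k [qn hk]]] : exists q (k : int), (1 <= q <= n)%N /\ - kappa *+ q = k%:~R.
  apply: contrapT => h; apply: hq => q k qn e; apply: h; by exists q, k.
have {hp} [p [l [pm hl]]] : exists p (l : int), (1 <= p <= m)%N /\ p%:R = - kappa *~ l.
  apply: contrapT => h; apply: hp => p l pm e; apply: h; by exists p, l.
have q0 : q%:R != 0 :> K by rewrite pnatr_eq0; lia.
have kE : kappa = - k%:~R / q%:R.
  by apply: (mulIf q0); rewrite mulfVK // -hk mulNrn opprK mulr_natr.
have pq : (p%:Z * q%:Z = k * l)%R.
  apply: (@intr_inj K); rewrite !rmorphM /= -[p%:~R]/(p%:R) hl kE -mulrzr.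
  by rewrite -[q%:~R]/(q%:R); field.
have k0 : k != 0.
  by apply: contraNneq kappa0 => k0; rewrite kE k0 oppr0 mul0r.
pose d := gcdn `|k| q.
have d0 : (0 < d)%N by rewrite gcdn_gt0; lia.
pose k1 := (`|k| %/ d)%N; pose q1 := (q %/ d)%N.
have kd : (`|k| = k1 * d)%N by rewrite divnK ?dvdn_gcdl.
have qd : (q = q1 * d)%N by rewrite divnK ?dvdn_gcdr.
have co : coprime k1 q1.
  rewrite /coprime -(eqn_pmul2r d0) muln_gcdl -kd -qd mul1n.
  exact: eqxx.
have k1p : (k1 %| p)%N.
  rewrite -(Gauss_dvdl _ co).
  have -> : (p * q1 = k1 * `|l|)%N; last exact: dvdn_mulr.
  apply/eqP; rewrite -(eqn_pmul2r d0) -mulnA -qd mulnAC -kd -abszM -pq.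
  by rewrite abszM.
have k1_gt0 : (0 < k1)%N by case: (k1) kd => //; lia.
exists k1, q1; split.
- by rewrite k1_gt0 (leq_trans (dvdn_leq _ k1p)) //; lia.
- by case/andP: qn; rewrite qd muln_gt0 => /andP[-> _] /=; apply/leq_trans/leq_pmulr.
have e : k1%:R / q1%:R = (`|k|%N)%:R / q%:R :> K.
  have dK : d%:R != 0 :> K by rewrite pnatr_eq0 -lt0n.
  have -> : (`|k|%N)%:R = k1%:R * d%:R :> K by rewrite -natrM -kd.
  have -> : q%:R = q1%:R * d%:R :> K by rewrite -natrM -qd.
  by rewrite -mulf_div divff ?mulr1.
rewrite e kE; case: (intP k) => [|N|N]; rewrite ?oppr0.
- by left; rewrite !mul0r.
- by right; rewrite mulNr.
- by left; rewrite mulrNz opprK abszN.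
Qed.

Lemma same_divisor_orbit z1 z2 : ~ special n m kappa ->
  same_divisor 1 (- kappa) (xs z1) (ys z1) (xs z2) (ys z2) -> Phi_orbit kappa z1 z2.
Proof.
have sx z : size (xs z) = n by rewrite size_map size_enum_ord.
have sy z : size (ys z) = m by rewrite size_map size_enum_ord.
have tr z w t : Phi_orbit kappa z w -> Phi_orbit kappa w t -> Phi_orbit kappa z t.
  exact: rt_trans.
case/not_special_incommensurable => inc d.
  exact: (same_divisor_related (oner_neq0 _) inc sx Phi_orbit_sym tr orbit_perm orbit_move).
have nk : - kappa != 0 by rewrite oppr_eq0.
apply: (same_divisor_related nk inc sy Phi_orbit_sym tr) => [z w /[swap]|z a /[swap]|].
- exact: orbit_perm.
- by move=> ax ay; have [w [zw wx wy]] := orbit_move ax ay; exists w.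
(* Exchanging [(x, al)] with [(y, be)] negates the divisor, which amounts to swapping the two sides
   and reversing their blocks. *)
- move: d; rewrite /same_divisor perm_sym.
  set A := xs z1; set B := map _ (ys z1); set C := map _ (xs z2); set D := ys z2.
  set A' := xs z2; set B' := map _ (ys z2); set C' := map _ (xs z1); set D' := ys z1.
  have swap (a b c e : seq K) : perm_eq (e ++ c ++ b ++ a) (a ++ b ++ c ++ e).
    by apply/seq.permP => P; rewrite !count_cat; lia.
  by move=> h; rewrite (perm_trans (swap _ _ _ _)) // (perm_trans h) // perm_sym swap.
Qed.

(** * The invariants as power sums of the divisor *)

(** The exponent is [l] itself, so [q_l] corresponds to [q_val l.+1]; the two extra exponents 0 and
    1 complete the list of power sums. *)
Definition q_val l z : K :=
  \sum_(i < n) (x_coord z i ^+ l - (x_coord z i - kappa) ^+ l) +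
  \sum_(p < m) ((y_coord z p + 1) ^+ l - y_coord z p ^+ l).

Lemma meval_q_poly l z : (q_poly n m kappa l).@[fun j => z 0 j] = q_val l.+1 z.
Proof.
have ex i : (x_poly m kappa i).@[fun j => z 0 j] = x_coord z i.
  by rewrite mevalD mevalXU mevalC.
have ey p : (y_poly n kappa p).@[fun j => z 0 j] = y_coord z p.
  by rewrite mevalD mevalZ mevalXU mevalC.
rewrite /q_poly mevalD !raddf_sum /=; congr (_ + _); apply: eq_bigr => i _.
  by rewrite mevalB !rmorphXn /= mevalB mevalC ex.
by rewrite mevalB !rmorphXn /= mevalD meval1 ey.
Qed.

Lemma sum_update (N : nat) (f g : 'I_N -> K) i :
  (forall j, j != i -> g j = f j) ->
  \sum_j g j = \sum_j f j + (g i - f i).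
Proof.
move=> fg; rewrite (bigD1 i) //= [in RHS](bigD1 i) //= (eq_bigr f) => [|j /fg//].
by ring.
Qed.

(** With [x_i = y_p = a], the two affected terms add up to [(a + 1)^l - (a - kappa)^l] both before
    and after the shift, the intermediate powers cancelling. *)
Lemma q_val_shift l i p z w : shift kappa i p z w -> q_val l z = q_val l w.
Proof.
move=> zw; have [/shift_defined xy _] := zw.
have hx := x_shift zw; have hy := y_shift zw.
pose fx z i := x_coord z i ^+ l - (x_coord z i - kappa) ^+ l.
pose fy z p := (y_coord z p + 1) ^+ l - y_coord z p ^+ l.
have fxw : \sum_j fx w j = \sum_j fx z j + (fx w i - fx z i).
  by apply: sum_update => j /negPf ji; rewrite /fx hx ji.
have fyw : \sum_j fy w j = \sum_j fy z j + (fy w p - fy z p).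
  by apply: sum_update => j /negPf jp; rewrite /fy hy jp.
rewrite -[LHS]/(\sum_j fx z j + \sum_j fy z j) -[RHS]/(\sum_j fx w j + \sum_j fy w j).
have -> : \sum_j fx w j = \sum_j fx z j - (fy w p - fy z p).
  rewrite fxw /fx /fy hx hy !eqxx xy [y_coord z p + 1 - kappa]addrAC.
  by ring.
by rewrite fyw; ring.
Qed.

Lemma q_val_orbit l z w : Phi_orbit kappa z w -> q_val l z = q_val l w.
Proof.
elim=> [a b|//|a b c _ -> _ -> //].
case=> [s t ->|i p|i p /q_val_shift //]; last exact: q_val_shift.
rewrite /q_val (reindex_inj (@perm_inj _ s)) [X in _ + X](reindex_inj (@perm_inj _ t)).
by congr (_ + _); apply: eq_bigr => i _; rewrite /x_coord /y_coord ?u_permute ?v_permute.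
Qed.

Lemma q_val_same_divisor z1 z2 :
  (forall l, (1 <= l)%N -> q_val l.+1 z1 = q_val l.+1 z2) ->
  same_divisor 1 (- kappa) (xs z1) (ys z1) (xs z2) (ys z2).
Proof.
move=> hq; apply: power_sums_perm_eq => k.
suff : q_val k z1 = q_val k z2.
  have sum_enum N (f : 'I_N -> K) (h : K -> K) :
      \sum_(a <- [seq h b | b <- [seq f j | j <- enum 'I_N]]) a ^+ k =
      \sum_j h (f j) ^+ k.
    by rewrite big_map big_map big_enum.
  have sum_enum_id N (f : 'I_N -> K) :
      \sum_(a <- [seq f j | j <- enum 'I_N]) a ^+ k = \sum_j f j ^+ k.
    by rewrite big_map big_enum.
  rewrite /q_val !sumrB !big_cat /= !sum_enum !sum_enum_id.
  have arith (a b c d a' b' c' d' : K) : a - b + (c - d) = a' - b' + (c' - d') ->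
      a + (c + (b' + d')) = a' + (c' + (b + d)).
    move=> h; have -> : a + (c + (b' + d')) = a - b + (c - d) + (b + d + b' + d') by ring.
    by rewrite h; ring.
  exact: arith.
(* For exponents 0 and 1 the value does not depend on the point: it is [0], respectively
   [n kappa + m]. *)
case: k => [|[|l]]; last exact: hq.
  by rewrite /q_val; congr (_ + _); apply: eq_bigr => i _; rewrite !expr0.
rewrite /q_val; congr (_ + _); apply: eq_bigr => i _; rewrite !expr1.
  by rewrite !subKr.
by rewrite ![_ + 1]addrC !addrK.
Qed.

(** A single generator separates: if all [q_l] agreed, the divisors would be equal and the orbits
    would coincide. *)
Lemma not_special_separates : ~ special n m kappa ->
  separates_orbits kappa (Lambda n m kappa).
Proof.
move=> nsp z1 z2 z12.
have [l l1 ql] : exists2 l, (1 <= l)%N & q_val l.+1 z1 <> q_val l.+1 z2.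
  apply: contrapT => h; apply/z12/Phi_orbit_eq/same_divisor_orbit => //.
  apply: q_val_same_divisor => l l1; apply: contrapT => ql; apply: h.
  by exists l.
exists (q_poly n m kappa l); first by apply: gen_mem; exists l.
by move=> w1 w2 /q_val_orbit h1 /q_val_orbit h2; rewrite !meval_q_poly -h1 -h2.
Qed.

End Orbits.

(** * Special [kappa]: distinct orbits with equal invariants *)

Lemma meval_Lambda_eq (K : numFieldType) (n m : nat) (kappa : K)
    (z w : 'rV[K]_(n + m)) (f : {mpoly K[n + m]}) :
  (forall l, q_val kappa l z = q_val kappa l w) -> Lambda n m kappa f ->
  f.@[fun j => z 0 j] = f.@[fun j => w 0 j].
Proof.
move=> hq; elim=> [_ [l _ ->]||a g h _ eg _ eh|g h _ eg _ eh].
- by rewrite !meval_q_poly hq.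
- by rewrite !meval1.
- by rewrite !mevalD !mevalZ eg eh.
- by rewrite !mevalM eg eh.
Qed.

Lemma telescope_prefix (V : zmodType) (N q : nat) (g : nat -> V) (F : 'I_N -> V) c :
  (q <= N)%N -> (forall i, F i = if (i < q)%N then g i.+1 - g i else c) ->
  \sum_i F i = g q - g 0%N + c *+ (N - q).
Proof.
move=> qN hF.
rewrite (eq_bigr (fun i : 'I_N => if (i < q)%N then g i.+1 - g i else c)) //.
rewrite -(big_mkord xpredT (fun i => if (i < q)%N then g i.+1 - g i else c)).
rewrite (big_cat_nat (leq0n q) qN) /=; congr (_ + _).
  rewrite -telescope_sumr // !big_nat; apply: eq_bigr => i /andP[_ ->] //.
rewrite -sumr_const_nat !big_nat; apply: eq_bigr => i /andP[qi _].
by rewrite ltnNge qi.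
Qed.

Section Special.
Variables (K : numClosedFieldType) (n m p q : nat) (kappa : K).
Hypotheses (pm : (1 <= p <= m)%N) (qn : (1 <= q <= n)%N) (kappa0 : kappa != 0).

(* The point with [x_i = b + (i + 1) kappa] for [i < q], [y_j = c + j] for
   [j < p], and all other coordinates [x_i], [y_j] zero. *)
Definition chain_point (b c : K) : 'rV[K]_(n + m) :=
  row_mx (\row_i ((if (i < q)%N then b + kappa *+ i.+1 else 0) - (2%:R^-1 + kappa)))
         (\row_j (((if (j < p)%N then c + j%:R else 0) - kappa / 2%:R) / kappa)).

Lemma x_chain_point b c i :
  x_coord kappa (chain_point b c) i = if (i < q)%N then b + kappa *+ i.+1 else 0.
Proof. by rewrite /x_coord /u_coord row_mxEl mxE subrK. Qed.

Lemma y_chain_point b c j :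
  y_coord kappa (chain_point b c) j = if (j < p)%N then c + j%:R else 0.
Proof.
by rewrite /y_coord /v_coord row_mxEr mxE mulrCA divff ?mulr1 ?subrK.
Qed.

(** Each string telescopes to its two ends. The last summand comes from the zero coordinates and is
    independent of [b] and [c]. *)
Lemma q_val_chain_point l b c :
  q_val kappa l (chain_point b c) =
  ((b + kappa *+ q) ^+ l - b ^+ l) + ((c + p%:R) ^+ l - c ^+ l)
  + ((0 ^+ l - (- kappa) ^+ l) *+ (n - q) + (1 - 0 ^+ l) *+ (m - p)).
Proof.
rewrite /q_val (@telescope_prefix _ n q (fun i => (b + kappa *+ i) ^+ l)
  _ (0 ^+ l - (- kappa) ^+ l)); first last.
- move=> i; rewrite x_chain_point; case: ifP => _; last by rewrite sub0r.
  by congr (_ - _ ^+ _); rewrite mulrSr addrA addrK.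
- by case/andP: qn.
rewrite (@telescope_prefix _ m p (fun j => (c + j%:R) ^+ l) _ (1 - 0 ^+ l)); first last.
- move=> j; rewrite y_chain_point; case: ifP => _; last by rewrite add0r expr1n.
  by rewrite -addrA -natr1.
- by case/andP: pm.
by rewrite !mulr0n !addr0; ring.
Qed.

(** Permutations and shifts by one keep the [u_i] real; this tells orbits apart even where all [q_l]
    agree. *)
Lemma orbit_u_real (z w : 'rV[K]_(n + m)) :
  Phi_orbit kappa z w -> (forall i, u_coord z i \is Num.real) ->
  forall i, u_coord w i \is Num.real.
Proof.
elim=> {z w} [z w|//|z w t _ hzw _ hwt hz]; last exact/hwt/hzw.
have one_real (b : bool) : b%:R \is @Num.real K by exact: realn.
case=> [s t -> h i|i j [_ ->] h k|i j [_ zw] h k].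
- by rewrite u_permute.
- by have := h k; rewrite /u_coord !mxE /= !eq_shift subr0 => hk; apply: rpredD.
- by have := h k; rewrite zw /u_coord !mxE /= !eq_shift subr0 addrC rpredDl.
Qed.

Lemma chain_points_not_separated b1 c1 c2 :
  kappa \is Num.real -> b1 \is Num.real ->
  (forall l, q_val kappa l (chain_point b1 c1) = q_val kappa l (chain_point (b1 + 'i) c2)) ->
  ~ separates_orbits kappa (Lambda n m kappa).
Proof.
move=> kr b1r hq sep.
have half_real : 2%:R^-1 + kappa \is Num.real by rewrite rpredD // rpredV realn.
have [|f Lf hf] := sep (chain_point b1 c1) (chain_point (b1 + 'i) c2); last first.
  by apply: (hf _ _ (rt_refl _ _ _) (rt_refl _ _ _)); apply: meval_Lambda_eq Lf.
move=> e; have : Phi_orbit kappa (chain_point (b1 + 'i) c2) (chain_point (b1 + 'i) c2).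
  exact: rt_refl.
rewrite -e => /orbit_u_real ureal.
have q0 : (0 < q)%N by case/andP: qn.
have n0 : (0 < n)%N by apply: leq_trans q0 _; case/andP: qn.
(* Index 0 lies in the string because [q >= 1], so this coordinate contains ['i]. *)
have := ureal _ (Ordinal n0).
rewrite /u_coord row_mxEl mxE /= q0 mulr1n => ireal.
have {ireal} : 'i \is @Num.real K.
  have -> : 'i = b1 + 'i + kappa - (2%:R^-1 + kappa) + (2%:R^-1 + kappa) - kappa - b1 :> K.
    by ring.
  rewrite !rpredB // rpredD //; apply: ireal => i.
  rewrite row_mxEl mxE rpredB //.
  by case: ifP => _; rewrite ?rpred0 // rpredD // rpredMn.
by move/Creal_ImP; rewrite Im_i => /eqP; rewrite oner_eq0.
Qed.

End Special.

Lemma special_not_separates (K : numClosedFieldType) (n m : nat) (kappa : K) :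
  kappa != 0 -> special n m kappa -> ~ separates_orbits kappa (Lambda n m kappa).
Proof.
move=> k0 [p [q [pm qn kE]]].
have q0 : q%:R != 0 :> K by rewrite pnatr_eq0; lia.
have kr : kappa \is Num.real.
  by case: kE => ->; rewrite ?rpredN rpred_div // realn.
case: kE => kE.
  have kq : kappa *+ q = p%:R by rewrite kE -[LHS]mulr_natr mulfVK.
  (* Both strings have total length [p], so exchanging their starting values [0] and ['i] only
     permutes the two telescoped differences. *)
  apply: (chain_points_not_separated qn (p := p) (b1 := 0) (c1 := 'i) (c2 := 0) kr) => // l.
  by rewrite !q_val_chain_point // kq !add0r; congr (_ + _); apply: addrC.
have kq : kappa *+ q = - p%:R by rewrite kE -[LHS]mulr_natr mulNr mulfVK.
(* Here the [x] string runs from [b] down to [b - p]; with [c = b - p] the [y] string runs back up,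
   and the two differences cancel for either value of [b]. *)
apply: (chain_points_not_separated qn (p := p) (b1 := 0) (c1 := - p%:R) (c2 := 'i - p%:R) kr) => // l.
rewrite !q_val_chain_point // kq !add0r subrK addNr; congr (_ + _).
by ring.
Qed.

Theorem theorem1p2 (R : realType) (n m : nat) (hn : (1 <= n)%N) (hm : (1 <= m)%N)
    (kappa : R[i]) (hkappa : kappa <> 0%R) :
  separates_orbits kappa (Lambda n m kappa) <-> ~ special n m kappa.
Proof.
have /eqP k0 := hkappa.
split; first by move=> sep /(special_not_separates k0).
exact: not_special_separates.
Qed.
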